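(* Let $X$ be a large scale paracompact coarse space and let $n\ge 0$ be an integer. Suppose that for every $\epsilon>0$ and every uniformly bounded cover $\mathcal{U}$ of $X$ there are $\delta>0$ and a uniformly bounded cover $\mathcal{V}$ of $X$ such that the following holds: for every simplicial complex $K$, every subset $A\subset X$, every $(\mathcal{V},\delta)$-partition of unity $f\colon X\to K$ and every function $g\colon A\to K^{(n)}$ such that $f|_A=i\circ g$, where $i\colon K^{(n)}\to K$ is the inclusion, there is a filler $h\colon X\to K^{(n)}$ that is a $(\mathcal{U},\epsilon)$-partition of unity. (Here $h$ being a filler means that $h|_A=g$ and that, for every $x\in X$ and every simplex $\Delta$ of $K$, $f(x)\in\Delta$ implies $h(x)\in\Delta$.) Then $\mathrm{asdim}(X)\leq n$.
   Context: Coarse spaces. A coarse space is a set $X$ with a large scale structure: a nonempty collection of families of subsets of $X$, called uniformly bounded families, such that (1) if $\mathcal{B}_1$ is uniformly bounded and every element of $\mathcal{B}_2$ with more than one point is contained in some element of $\mathcal{B}_1$, then $\mathcal{B}_2$ is uniformly bounded; (2) if $\mathcal{B}_1,\mathcal{B}_2$ are uniformly bounded then so is $\{st(B,\mathcal{B}_2) : B\in\mathcal{B}_1\}$, where $st(B,\mathcal{B}_2)$ is the union of all elements of $\mathcal{B}_2$ intersecting $B$. (This is equivalent to Roe's coarse structures: $\mathcal{B}$ is uniformly bounded iff $\bigcup_{B\in\mathcal{B}}B\times B$ is controlled.) Asymptotic dimension. $\mathrm{asdim}(X)\le n$ means: for every uniformly bounded cover $\mathcal{U}$ of $X$ there is a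 uniformly bounded cover $\mathcal{V}$ of $X$ such that every element $U$ of $\mathcal{U}$ intersects at most $n+1$ elements of $\mathcal{V}$. Simplicial complexes. For a set $S$, the full complex $\Delta(S)$ is the set of finitely supported functions $f\colon S\to[0,1]$ with $\sum_{s\in S}f(s)=1$, with the metric inherited from $l^1(S)$. A simplicial complex $K$ is a subcomplex of some $\Delta(S)$, with the induced $l^1$-metric; $K^{(0)}$ is its set of vertices and $K^{(n)}$ its $n$-skeleton. The star $st(v)$ of a vertex $v$ is the set of all $f\in K$ with $f(v)>0$. Any function $f\colon X\to K$ is viewed as a point-finite partition of unity $\{f_v\}_{v\in K^{(0)}}$, $f_v(x):=f(x)(v)$. $(\mathcal{U},\epsilon)$-partitions of unity. For a cover $\mathcal{U}$ of $X$ and a function $f$ from $X$ to a metric space, $var_{\mathcal{U}}(f)$ is the supremum of $d(f(x),f(y))$ over all $x,y$ contained in a common element of $\mathcal{U}$. A function $f\colon X\to K$ is a $(\mathcal{U},\epsilon)$-partition of unity if: (i) $var_{\mathcal{U}}(f)<\epsilon$; (ii) for every $U\in\mathcal{U}$ there is $v\in K^{(0)}$ with $f_v(y)>0$ for all $y\in U$; (iii) $\{f^{-1}(st(v))\}_{v\in K^{(0)}}$ is a uniformly bounded cover of $X$. Large scale paracompactness. A coarse space $X$ is large scale paracompact if for every uniformly bounded cover $\mathcal{U}$ of $X$ and every $\epsilon>0$ there is a $(\mathcal{U},\epsilon)$-partition of unity $f\colon X\to K$ for some simplicial complex $K$. *)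

(* Defs.v *)
From HB Require Import structures.
From mathcomp Require Import all_boot all_order all_algebra.
From mathcomp Require Import all_classical all_reals ereal.

Set Implicit Arguments.
Unset Strict Implicit.
Unset Printing Implicit Defensive.

Import Order.TTheory GRing.Theory Num.Theory.
Local Open Scope classical_set_scope.
Local Open Scope card_scope.
Local Open Scope ring_scope.

Definition st (X : Type) (B : set X) (F : set (set X)) : set X :=
  \bigcup_(C in [set C | F C /\ C `&` B !=set0]) C.

HB.mixin Record isCoarse (X : Type) := {
  unif_bounded : set (set (set X)) ;
  unif_bounded_nonempty : unif_bounded !=set0 ;
  unif_bounded_refine : forall F1 F2 : set (set X), unif_bounded F1 ->
    (forall B, F2 B -> (exists x y, [/\ B x, B y & x <> y]) ->
       exists2 C, F1 C & B `<=` C) ->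
    unif_bounded F2 ;
  unif_bounded_star : forall F1 F2 : set (set X), unif_bounded F1 ->
    unif_bounded F2 -> unif_bounded [set st B F2 | B in F1] }.

#[short(type="coarseType")]
HB.structure Definition Coarse := {X of isCoarse X}.

Definition unif_bounded_cover (X : coarseType) (U : set (set X)) :=
  unif_bounded U /\ \bigcup_(B in U) B = setT.

Definition asdim_le (X : coarseType) (n : nat) :=
  forall U : set (set X), unif_bounded_cover U ->
  exists2 V : set (set X), unif_bounded_cover V &
    forall B, U B -> [set C | V C /\ C `&` B !=set0] #<= `I_n.+1.

(* Vertex sets are choice types because [\sum_(_ \in _)] requires one; every
   type is one classically, see [{classic T}]. *)
Definition full_complex (R : realType) (S : choiceType) : set (S -> R) :=
  [set f | [/\ finite_set [set s | f s != 0],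
               forall s, 0 <= f s <= 1 &
               \sum_(s \in [set: S]) f s = 1]].
Arguments full_complex : clear implicits.

(* The sum is the l^1 distance only when f and g differ at finitely many
   places, as is the case on [full_complex R S]. *)
Definition l1_dist (R : realType) (S : choiceType) (f g : S -> R) : R :=
  \sum_(s \in [set: S]) `|f s - g s|.

Definition simplex (R : realType) (S : choiceType) (sigma : set S) :
    set (S -> R) :=
  full_complex R S `&` [set f | [set s | f s != 0] `<=` sigma].
Arguments simplex R {S} sigma.

Definition is_subcomplex (R : realType) (S : choiceType) (K : set (S -> R)) :=
  exists2 F : set (set S),
    (forall sigma, F sigma -> finite_set sigma /\ sigma !=set0) &
    K = \bigcup_(sigma in F) simplex R sigma.

Record simplicialComplex (R : realType) := SimplicialComplex {
  ambient_vertex : choiceType ;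
  points :> set (ambient_vertex -> R) ;
  pointsP : is_subcomplex points }.

(* Simplices and vertices of K are recorded by the sets of vertices spanning
   them, so a vertex of K is an element of the ambient set. *)
Definition simplices (R : realType) (K : simplicialComplex R) :
    set (set (ambient_vertex K)) :=
  [set sigma | [/\ finite_set sigma, sigma !=set0 & simplex R sigma `<=` K]].
Arguments simplices {R} K.

Definition vertices (R : realType) (K : simplicialComplex R) :
    set (ambient_vertex K) :=
  [set v | simplices K [set v]].
Arguments vertices {R} K.

Definition skeleton_points (R : realType) (K : simplicialComplex R) (n : nat) :
    set (ambient_vertex K -> R) :=
  \bigcup_(sigma in simplices K `&` [set sigma | sigma #<= `I_n.+1])
    simplex R sigma.
Arguments skeleton_points {R} K n.

Lemma skeleton_subproof (R : realType) (K : simplicialComplex R) (n : nat) :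
  is_subcomplex (skeleton_points K n).
Proof.
by exists (simplices K `&` [set sigma | sigma #<= `I_n.+1]) => // sigma [[]].
Qed.

Definition skeleton (R : realType) (K : simplicialComplex R) (n : nat) :
    simplicialComplex R :=
  SimplicialComplex (skeleton_subproof K n).

Definition vertex_star (R : realType) (K : simplicialComplex R)
    (v : ambient_vertex K) : set (ambient_vertex K -> R) :=
  K `&` [set f | 0 < f v].
Arguments vertex_star {R} K v.

Definition variation (R : realType) (X M : Type) (d : M -> M -> R)
    (U : set (set X)) (f : X -> M) : \bar R :=
  ereal_sup [set r | exists B x y,
    [/\ U B, B x, B y & r = (d (f x) (f y))%:E]].

Definition is_pou (R : realType) (X : coarseType) (K : simplicialComplex R)
    (U : set (set X)) (eps : R) (f : X -> ambient_vertex K -> R) :=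
  [/\ set_fun [set: X] K f,
      (variation (@l1_dist R _) U f < eps%:E)%E,
      forall B, U B -> exists2 v, vertices K v & forall y, B y -> 0 < f y v &
      unif_bounded_cover [set f @^-1` vertex_star K v | v in vertices K]].
Arguments is_pou {R X} K U eps f.

Definition large_scale_paracompact (R : realType) (X : coarseType) :=
  forall (U : set (set X)) (eps : R), unif_bounded_cover U -> 0 < eps ->
  exists (K : simplicialComplex R) (f : X -> ambient_vertex K -> R),
    is_pou K U eps f.

(* Only the values of g on A matter. *)
Definition is_filler (R : realType) (X : Type) (K : simplicialComplex R)
    (n : nat) (A : set X) (f g h : X -> ambient_vertex K -> R) :=
  [/\ set_fun [set: X] (skeleton K n) h,
      forall x, A x -> h x = g x &
      forall x sigma, simplices K sigma ->
        simplex R sigma (f x) -> simplex R sigma (h x)].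
Arguments is_filler {R X} K n A f g h.

(* Main.v *)
Require Import Defs.
From mathcomp Require Import all_boot all_order all_algebra.
From mathcomp Require Import all_classical all_reals.

(** A partition of unity h into an n-dimensional complex has at most n+1
    positive coordinates at each point, so the sets {h_v > 0} form a cover of
    multiplicity at most n+1. To pass from the points of X to the elements of a
    given cover U, shrink each {h_v > 0} to its U-interior: the points x with
    st(x, U) inside {h_v > 0}. A set B of U meeting the U-interior of {h_v > 0}
    lies entirely in {h_v > 0}, so one point of B sees every such v, and there
    are at most n+1 of them. The U-interiors still cover X as soon as each
    st(x, U) has a coordinate of h positive throughout it, which is the
    Lebesgue condition for the cover by the sets st(x, U) ([skeleton_pou_asdim]).
    The fillers provide such an h: apply the hypothesis with A empty to any
    sufficiently fine partition of unity of X. *)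

Import Order.TTheory GRing.Theory Num.Theory.

Local Open Scope classical_set_scope.
Local Open Scope ring_scope.

Definition point_stars (X : Type) (U : set (set X)) : set (set X) :=
  [set st [set x] U | x in setT].

Definition star_interior (X : Type) (U : set (set X)) (C : set X) : set X :=
  [set x | st [set x] U `<=` C].

Lemma sub_point_star (X : Type) (U : set (set X)) (B : set X) (x : X) :
  U B -> B x -> B `<=` st [set x] U.
Proof. by move=> UB Bx y By; exists B => //; split=> //; exists x. Qed.

Lemma point_star_self (X : coarseType) (U : set (set X)) (x : X) :
  unif_bounded_cover U -> st [set x] U x.
Proof.
move=> [_ Ucover].
have [B UB Bx] : (\bigcup_(B in U) B) x by rewrite Ucover.
exact: (sub_point_star _ U B x).
Qed.

(** The family of singletons is uniformly bounded because its elements have no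
    two distinct points, so its star along U is uniformly bounded too. *)
Lemma point_stars_cover {X : coarseType} {U : set (set X)} :
  unif_bounded_cover U -> unif_bounded_cover (point_stars X U).
Proof.
move=> Ucov; split; last first.
  rewrite -subTset => x _; exists (st [set x] U); first by exists x.
  exact: point_star_self.
have singletons : unif_bounded [set [set x] | x in [set: X]].
  apply: unif_bounded_refine (proj1 Ucov) _ => _ [x _ <-] [y [z [-> ->]]].
  by [].
apply: unif_bounded_refine (unif_bounded_star _ _ singletons (proj1 Ucov)) _.
move=> _ [x _ <-] _; exists (st [set x] U) => //.
by exists [set x] => //; exists x.
Qed.

Lemma star_interior_sub (X : coarseType) (U : set (set X)) (C : set X) :
  unif_bounded_cover U -> star_interior X U C `<=` C.
Proof. by move=> Ucov x; apply; exact: point_star_self. Qed.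

(** One point of B already lies in every C whose interior meets B, so the
    number of interiors meeting B is bounded by the multiplicity at a point. *)
Lemma meet_star_interior (X : Type) (U : set (set X)) (B C : set X) :
  U B -> star_interior X U C `&` B !=set0 -> B `<=` C.
Proof.
by move=> UB [x [Cx Bx]]; apply: subset_trans Cx; exact: sub_point_star.
Qed.

Lemma skeleton_support (R : realType) (K : simplicialComplex R) (n : nat)
    (p : ambient_vertex K -> R) :
  skeleton_points K n p -> ([set v | 0 < p v] #<= `I_n.+1)%card.
Proof.
move=> [sigma [_ sigma_n] [_ p_sigma]]; apply: card_le_trans sigma_n.
apply: subset_card_le => v /= pv; apply: p_sigma => /=.
by rewrite gt_eqF.
Qed.

(** The bounded cover is made of the U-interiors of the sets {h_v > 0}: the
    Lebesgue condition along st(x, U) puts x in one of them. *)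
Lemma skeleton_pou_asdim (R : realType) (X : coarseType) (n : nat)
    (U : set (set X)) (eps : R) (K : simplicialComplex R)
    (h : X -> ambient_vertex K -> R) :
  unif_bounded_cover U ->
  is_pou (skeleton K n) (point_stars X U) eps h ->
  exists2 V : set (set X), unif_bounded_cover V &
    forall B, U B -> ([set C | V C /\ C `&` B !=set0] #<= `I_n.+1)%card.
Proof.
move=> Ucov [h_skel _ h_lebesgue [h_bounded _]].
pose S v := h @^-1` vertex_star (skeleton K n) v.
exists [set star_interior X U (S v) | v in vertices (skeleton K n)].
  split.
    apply: unif_bounded_refine h_bounded _ => _ [v Kv <-] _.
    by exists (S v); [exists v | exact: star_interior_sub].
  rewrite -subTset => x _.
  have [|v Kv v_pos] := h_lebesgue (st [set x] U); first by exists x.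
  exists (star_interior X U (S v)); first by exists v.
  by move=> y /v_pos hy; split=> //; exact: h_skel.
move=> B UB.
have [[b Bb]|B0] := pselect (B !=set0); last first.
  rewrite [X in (X #<= _)%card](_ : _ = set0) ?card_ge0 //.
  by rewrite -subset0 => C [_ [x [_ Bx]]]; apply: B0; exists x.
apply: card_le_trans (skeleton_support _ _ _ _ (h_skel b I)).
apply: card_le_trans (card_image_le (fun v => star_interior X U (S v)) _).
apply: subset_card_le => _ [[v _ <-] meet]; exists v => //.
by have [] := meet_star_interior _ _ _ _ UB meet b Bb.
Qed.

Theorem corollary5p2 (R : realType) (X : coarseType) (n : nat)
  (X_paracompact : large_scale_paracompact R X)
  (X_fillers : forall (eps : R) (U : set (set X)),
     0 < eps -> unif_bounded_cover U ->
     exists (delta : R) (V : set (set X)),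
       [/\ 0 < delta, unif_bounded_cover V &
         forall (K : simplicialComplex R) (A : set X)
                (f g : X -> ambient_vertex K -> R),
           is_pou K V delta f ->
           set_fun A (skeleton K n) g ->
           (forall x, A x -> f x = g x) ->
           exists h : X -> ambient_vertex K -> R,
             is_filler K n A f g h /\ is_pou (skeleton K n) U eps h]) :
  asdim_le X n.
Proof.
move=> U Ucov.
have [delta [V [delta_gt0 Vcov fill]]] :=
  X_fillers 1 _ ltr01 (point_stars_cover Ucov).
have [K [f f_pou]] := X_paracompact V delta Vcov delta_gt0.
have [//|//|h [_ h_pou]] := fill K set0 f f f_pou.
exact: skeleton_pou_asdim Ucov h_pou.
Qed.
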